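(* Let $P$ be a finite poset, $\Bbbk$ a field, and $R=\{1\}\times R_1\cup\{2\}\times R_2\subseteq[2]\times P$ with $R_1,R_2$ nonempty. If $R_1\le R_2$ does not hold, then $\Delta(2,P)_{|R}$ is contractible, and so all the reduced homology of $\Delta(2,P)_{|R}$ vanishes. Hence $\beta_{i,R}(L(2,P))$ can be nonzero only if $R_1\le R_2$.
   Context: $[2]=\{1,2\}$. The letterplace ideal $L(2,P)$ is the ideal in $S=\Bbbk[x_{i,p} : (i,p)\in[2]\times P]$ generated by the monomials $x_{1,p_1}x_{2,p_2}$ with $p_1\le p_2$ in $P$. $\Delta(2,P)$ is the simplicial complex on $[2]\times P$ with Stanley-Reisner ideal $L(2,P)$, and $\Delta(2,P)_{|R}$ is its restriction, consisting of all faces contained in $R$. For $R\subseteq [2]\times P$ and $i\ge0$, $\beta_{i,R}(L(2,P)) = \dim_\Bbbk \mathrm{Tor}_i^S(L(2,P),\Bbbk)_R$, where the multidegree $R$ means the $0/1$ exponent vector with support $R$. For nonempty subsets $A,B$ of $P$ write $A\le B$ if: for every maximal element $a$ of $A$ there is a minimal element $b$ of $B$ with $a\le b$, and for every minimal element $b$ of $B$ there is a maximal element $a$ of $A$ with $a\le b$. *)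

(* Defs.v *)
From HB Require Import structures.
From mathcomp Require Import all_boot all_order all_algebra.
From mathcomp Require Import all_classical all_reals all_analysis.
(* The notations of mpoly clash with those of mathcomp-analysis. *)
From mathcomp Require Import -(notations) mpoly.
Set Implicit Arguments.
Unset Strict Implicit.
Unset Printing Implicit Defensive.
Import Order.TTheory GRing.Theory Num.Theory.
Import numFieldNormedType.Exports.
Local Open Scope ring_scope.

(** * Finite posets *)

Section PosetSubsets.
Context {d : Order.disp_t} {P : finPOrderType d}.

Definition maximal_in (A : {set P}) (a : P) : Prop :=
  a \in A /\ forall x, x \in A -> (a <= x)%O -> x = a.

Definition minimal_in (A : {set P}) (a : P) : Prop :=
  a \in A /\ forall x, x \in A -> (x <= a)%O -> x = a.

Definition set_le (A B : {set P}) : Prop :=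
  (forall a, maximal_in A a -> exists2 b, minimal_in B b & (a <= b)%O) /\
  (forall b, minimal_in B b -> exists2 a, maximal_in A a & (a <= b)%O).

End PosetSubsets.

(** * Abstract simplicial complexes *)

Section Complexes.
Context {V : finType}.

Definition simplicial_complex (K : {set {set V}}) : Prop :=
  forall F G : {set V}, F \in K -> G \subset F -> G \in K.

Definition restriction (K : {set {set V}}) (W : {set V}) : {set {set V}} :=
  [set F in K | F \subset W]%SET.

(* The vertex v has barycentric coordinate x 0 (enum_rank v).  As K is
   finite, its realization carries the subspace topology of R^V. *)
Definition realization (R : realType) (K : {set {set V}}) :
    set 'rV[R]_#|V| :=
  [set x : 'rV[R]_#|V| | [/\ forall i, 0 <= x 0 i, \sum_i x 0 i = 1 &
      [set v : V | x 0 (enum_rank v) != 0]%SET \in K]]%classic.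

End Complexes.

Arguments realization {V} R K _.

Section Contractible.
Local Open Scope classical_set_scope.

Definition contractible_space (R : realType) (T : topologicalType)
    (A : set T) : Prop :=
  exists (x0 : T) (H : R * T -> T),
    [/\ A x0,
        {within `[0, 1] `*` A, continuous H},
        forall t x, 0 <= t <= 1 -> A x -> A (H (t, x)),
        forall x, A x -> H (0, x) = x &
        forall x, A x -> H (1, x) = x0].

Definition contractible (R : realType) (V : finType) (K : {set {set V}}) :
    Prop := contractible_space R (realization R K).

End Contractible.

(** * Homology *)

(* Row space: the span of the standard basis vectors indexed by D. *)
Definition coord_mx (k : fieldType) (m : nat) (D : pred 'I_m) : 'M[k]_m :=
  diag_mx (\row_j (D j)%:R).

(* Dimension of the quotient of Z by B, for row spaces with B <= Z. *)
Definition quotient_dim (k : fieldType) (m1 m2 m : nat)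
    (Z : 'M[k]_(m1, m)) (B : 'M[k]_(m2, m)) : nat := \rank (Z :\: B)%MS.

Section ReducedHomology.
Variables (k : fieldType) (V : finType).
Implicit Types (K : {set {set V}}) (c : nat).

(* Acting on row vectors indexed by the subsets F of V; the vertices are
   oriented by their rank in enum V.  A vertex is sent to the empty face, so
   this is the augmented chain complex. *)
Definition boundary_mx : 'M[k]_#|{set V}| :=
  \matrix_(s, t) \sum_(v in (enum_val s : {set V}) |
                       enum_val t == (enum_val s : {set V}) :\ v)
    (-1) ^+ #|[set u in (enum_val s : {set V}) |
               (enum_rank u < enum_rank v)%N]|.

Definition chains_mx K c : 'M[k]_#|{set V}| :=
  coord_mx k (fun s => (enum_val s \in K) && (#|enum_val s : {set V}| == c)).

(* The dimension of the reduced homology of K in degree c - 1: the index is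
   the cardinality of faces, so that it starts in degree -1 with the empty
   face. *)
Definition reduced_homology_dim K c : nat :=
  quotient_dim (chains_mx K c :&: kermx boundary_mx)%MS
               (chains_mx K c.+1 *m boundary_mx).

End ReducedHomology.

(** * Ideals and Stanley-Reisner complexes

    The polynomial ring with variables indexed by a finite type V is
    mpoly #|V| k, where v stands for the variable number enum_rank v. *)

Definition ideal_gen (S : comNzRingType) (G : set S) : set S :=
  [set f | exists s : seq (S * S),
     (forall p, p \in s -> G p.2) /\ f = \sum_(p <- s) p.1 * p.2]%classic.

Section StanleyReisner.
Variables (k : fieldType) (V : finType).

Definition var (v : V) : mpoly #|V| k := mpolyX k (mnm1 (enum_rank v)).

Definition face_monomial (F : {set V}) : mpoly #|V| k := \prod_(v in F) var v.

Definition SR_ideal (K : {set {set V}}) : set (mpoly #|V| k) :=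
  ideal_gen [set f | exists2 F, F \notin K & f = face_monomial F]%classic.

Definition SR_complex (I : set (mpoly #|V| k)) : {set {set V}} :=
  [set F | ~~ `[< I (face_monomial F) >]]%SET.

(* The 0/1 exponent vector with support W. *)
Definition support_mnm (W : {set V}) : multinom #|V| :=
  Multinom [tuple nat_of_bool (enum_val i \in W) | i < #|V|].

End StanleyReisner.

Arguments SR_ideal k [V] K _.

(** * Multigraded Tor *)

Section MultigradedTor.
Variables (k : fieldType) (n : nat).
Local Notation S := (mpoly n k).

(* f is homogeneous of multidegree b - a: a scalar times the monomial with
   exponent b - a, and 0 if b - a has a negative entry. *)
Definition mhomog_from_to (a b : multinom n) (f : S) : Prop :=
  forall m, m \in msupp f -> mnm_add m a = b.

(* A multigraded resolution of the ideal I by finitely generated free modules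
   F_i, with a basis of rk i elements of multidegrees mdeg i.  Elements of F_i
   are row vectors, on which the matrices act on the right. *)
Record free_resolution (I : set S) := FreeResolution {
  rk : nat -> nat;
  mdeg_of : forall i, 'I_(rk i) -> multinom n;
  diff : forall i, 'M[S]_(rk i.+1, rk i);
  aug : 'cV[S]_(rk 0);
  diff_homog : forall i j l,
    mhomog_from_to (mdeg_of l) (mdeg_of j) (diff i j l);
  aug_homog : forall j, mhomog_from_to mnm0 (mdeg_of j) (aug j 0);
  aug_image : forall f, I f <-> exists v : 'rV[S]_(rk 0), v *m aug = f%:M;
  exact_aug : forall v : 'rV[S]_(rk 0),
    v *m aug = 0 <-> exists w : 'rV[S]_(rk 1), v = w *m diff 0;
  exact_diff : forall i (v : 'rV[S]_(rk i.+1)),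
    v *m diff i = 0 <-> exists w : 'rV[S]_(rk i.+2), v = w *m diff i.+1
}.

Section Tor.
Variables (I : set S) (F : free_resolution I).

(* The degree a part of the tensor product of F_i with k. *)
Definition tensor_part (a : multinom n) (i : nat) : 'M[k]_(rk F i) :=
  coord_mx k (fun j => mdeg_of j == a).

(* The differential of the tensor product with k = S / (x_1, ..., x_n): only
   the constant terms remain. *)
Definition tensor_diff (i : nat) : 'M[k]_(rk F i.+1, rk F i) :=
  map_mx (mcoeff mnm0) (diff F i).

Definition tensor_ker (i : nat) : 'M[k]_(rk F i) :=
  match i with
  | 0 => 1%:M
  | j.+1 => kermx (tensor_diff j)
  end.

Definition tor_dim (i : nat) (a : multinom n) : nat :=
  quotient_dim (tensor_part a i :&: tensor_ker i)%MS
               (tensor_part a i.+1 *m tensor_diff i).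

End Tor.

(* b = dim_k Tor_i^S(I, k)_a. *)
Definition is_betti_number (I : set S) (i : nat) (a : multinom n) (b : nat) :
    Prop :=
  exists F : free_resolution I, tor_dim F i a = b.

End MultigradedTor.

(** * Letterplace ideals

    The elements 1 and 2 of [2] are ord0 and ord_max in 'I_2. *)

Section Letterplace.
Variables (k : fieldType) (d : Order.disp_t) (P : finPOrderType d).
Local Notation V := ('I_2 * P)%type.

Definition letterplace2 : set (mpoly #|{: V}| k) :=
  ideal_gen [set f | exists p1 p2 : P, (p1 <= p2)%O /\
    f = var k ((ord0, p1) : V) * var k ((ord_max, p2) : V)]%classic.

Definition Delta2 : {set {set V}} := SR_complex letterplace2.

Definition two_layers (R1 R2 : {set P}) : {set V} :=
  finset.setX [set ord0] R1 :|: finset.setX [set ord_max] R2.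

Lemma Delta2_complex : simplicial_complex Delta2.
Proof.
move=> F G; rewrite !inE => /asboolPn nF sGF; apply/asboolPn => -[s [sG defG]].
apply: nF; have -> : face_monomial k F = face_monomial k (F :\: G) * face_monomial k G.
  rewrite /face_monomial [LHS](big_setID G) /= mulrC; congr (_ * _).
  by rewrite (finset.setIidPr sGF).
exists [seq (face_monomial k (F :\: G) * p.1, p.2) | p <- s]; split.
  by move=> p /mapP[q qs ->] /=; exact: sG.
by rewrite big_map /= defG mulr_sumr; apply: eq_bigr => p _; rewrite mulrA.
Qed.

Lemma Delta2_SR_ideal : SR_ideal k Delta2 = letterplace2.
Proof.
apply/seteqP; split=> f [s [sG ->]]; last first.
  exists s; split=> // p /sG[p1 [p2 [le12 def_p]]].
  have def_m : p.2 = face_monomial k [set (ord0, p1); (ord_max, p2)]%SET.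
    by rewrite /face_monomial finset.big_setU1 ?inE //= finset.big_set1.
  exists [set (ord0, p1); (ord_max, p2)]%SET => //.
  rewrite inE negbK; apply/asboolP; rewrite -def_m.
  exists [:: (1, p.2)]; split; last by rewrite big_seq1 mul1r.
  by move=> q; rewrite inE => /eqP-> /=; exists p1, p2.
elim: s sG => [|p s IHs] sG.
  by exists [::]; rewrite !big_nil.
have [t [tG deft]] := IHs (fun q qs => sG q (mem_behead (s := p :: s) qs)).
have [F] := sG p (mem_head _ _).
rewrite inE negbK => /asboolP[u [uG defu]] def_p.
exists ([seq (p.1 * q.1, q.2) | q <- u] ++ t); split.
  move=> q; rewrite mem_cat => /orP[/mapP[r ru ->] /=|]; first exact: uG.
  exact: tG.
rewrite big_cons big_cat big_map /= -deft def_p defu mulr_sumr.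
by congr (_ + _); apply: eq_bigr => q _; rewrite mulrA.
Qed.

End Letterplace.

Arguments letterplace2 k {d} P _.

(* Main.v *)
Require Import Defs.
From HB Require Import structures.
From mathcomp Require Import all_boot all_order all_algebra.
From mathcomp Require Import all_classical all_reals all_analysis.
From mathcomp Require Import ring lra.
From mathcomp Require Import -(notations) mpoly.
Set Implicit Arguments.
Unset Strict Implicit.
Unset Printing Implicit Defensive.
Import Order.TTheory GRing.Theory Num.Theory.
Import numFieldNormedType.Exports.
Local Open Scope ring_scope.

(** Suppose that a maximal element a of R_1 lies below no minimal element of
    R_2.  A set of vertices is a face of Delta(2,P) when it contains no pair
    (1,p), (2,q) with p <= q ([Delta2P]).  Let y in R_2 lie above a, and let b
    be a minimal element of R_2 below y.  Then a is not below b, and (2,b) can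
    be added to every face that contains (2,y), because an element below b is
    below y: the vertex (2,y) is dominated by (2,b).  To a face that contains
    none of these vertices (2,y), the vertex (1,a) can be added.  So the
    restriction of Delta(2,P) to R becomes a cone with apex (1,a) when dominated
    vertices are deleted.  The other way in which R_1 <= R_2 can fail, a minimal
    element of R_2 above no maximal element of R_1, is order-dual.

    The record [dominated_cone] keeps exactly this information about a complex,
    and the three conclusions are derived from it.

    Contractibility ([dominated_cone_contractible]).  The identity and the map
    that sends every dominated vertex to its dominator are contiguous, and the
    latter is contiguous to the constant map to the apex.  Both straight-line
    homotopies stay in the realization, and they are joined into one formula.

    Homology ([dominated_cone_acyclic]).  If w dominates v, subtracting from a
    cycle z the boundary of the cone with apex w over the part of z that
    involves v gives a cycle that avoids v.  After all deletions the complex is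
    a cone, where each cycle bounds the cone over itself.

    Betti numbers ([tor_dominated_cone]).  Let F be a multigraded free
    resolution of I, the ideal L(2,P).  Each entry of its differentials is a
    scalar times a monomial determined by the degrees, so nothing is lost when
    all variables are set to 1: this leaves matrices over k between bases
    labelled by multidegrees.  For sets C and B of variables, the basis elements with
    degree between C and B span a subquotient [C,B] of the augmented complex.
    - [0,B] is the strand of the augmented resolution in degree B, so it is
      exact.
    - For v in B there is a short exact sequence
      0 -> [C, B - v] -> [C, B] -> [C + v, B] -> 0, provided that C is nonempty
      or the monomials of B and B - v are both in I or both outside.  Exactness
      of the first two complexes gives exactness of the third ([exact_setU1]).
    - If w can be added to the face B - w, or B - w is not a face, the case C = 0
      of the sequence, with v = w, gives exactness of [{w}, B].
    When w dominates v, this yields exactness of [R - v, R], and [R - v, R - v]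
    is exact by induction, so [R, R] is exact; but the homology of [R, R] is
    Tor(I,k) in degree R. *)

(** * Coordinate subspaces *)

Section CoordinateProjections.
Variable k : fieldType.

Lemma quotient_dim_eq0 (m1 m2 m : nat) (Z : 'M[k]_(m1, m)) (B : 'M[k]_(m2, m)) :
  (Z <= B)%MS -> quotient_dim Z B = 0%N.
Proof.
move=> sZB; apply/eqP; rewrite -(eqn_add2l (\rank (Z :&: B)%MS)) addn0.
by rewrite mxrank_cap_compl (capmx_idPl sZB).
Qed.

Lemma mul_coord_mx m (D : pred 'I_m) n (A : 'M[k]_(n, m)) i j :
  (A *m coord_mx k D) i j = if D j then A i j else 0.
Proof. by rewrite mul_mx_diag !mxE; case: (D j); rewrite ?mulr1 ?mulr0. Qed.

Lemma sub_coord_mx m (D : pred 'I_m) (x : 'rV[k]_m) :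
  (x <= coord_mx k D)%MS -> x *m coord_mx k D = x.
Proof.
case/submxP=> y ->; apply/rowP=> j; rewrite !mul_coord_mx.
by case: (D j).
Qed.

Lemma mul_coord_mxl m n (D : pred 'I_m) (A : 'M[k]_(m, n)) i j :
  (coord_mx k D *m A) i j = if D i then A i j else 0.
Proof. by rewrite mul_diag_mx !mxE; case: (D i); rewrite ?mul1r ?mul0r. Qed.

Lemma eq_coord_mx m (D E : pred 'I_m) : D =1 E -> coord_mx k D = coord_mx k E.
Proof. by move=> eqDE; congr diag_mx; apply/rowP=> j; rewrite !mxE eqDE. Qed.

Lemma mul_coord_coord m (D E : pred 'I_m) :
  coord_mx k D *m coord_mx k E = coord_mx k (predI D E).
Proof.
rewrite mulmx_diag; congr diag_mx; apply/rowP=> j; rewrite !mxE /=.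
by rewrite -natrM mulnb.
Qed.

Lemma coord_mx_id m (D : pred 'I_m) :
  coord_mx k D *m coord_mx k D = coord_mx k D.
Proof. by rewrite mul_coord_coord; apply: eq_coord_mx => j /=; rewrite andbb. Qed.

Lemma coord_mx_pred0 m (D : pred 'I_m) : D =1 pred0 -> coord_mx k D = 0.
Proof.
by move=> D0; apply/matrixP=> i j; rewrite !mxE D0 mul0rn.
Qed.

Lemma coord_mxD m (D E : pred 'I_m) :
  coord_mx k D =
  coord_mx k (predI D (predC E)) + coord_mx k (predI D E).
Proof.
rewrite -raddfD /=; congr diag_mx; apply/rowP=> j; rewrite !mxE /=.
by case: (D j); case: (E j); rewrite /= ?addr0 ?add0r.
Qed.

Lemma coord_block_eq0 m n (D : pred 'I_m) (E : pred 'I_n) (A : 'M[k]_(m, n)) :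
  (forall i j, D i -> E j -> A i j = 0) -> coord_mx k D *m A *m coord_mx k E = 0.
Proof.
move=> A0; apply/matrixP=> i j; rewrite mul_coord_mx mul_coord_mxl [RHS]mxE.
by case Ej: (E j); case Di: (D i) => //; exact: A0.
Qed.

End CoordinateProjections.

(** * Complexes that reduce to a cone *)

Section DominatedCone.
Variable V : finType.
Implicit Types (K : {set {set V}}) (R bad F : {set V}) (c v w : V).

(** Deleting the vertices of bad, each dominated by its image under phi, leaves
    a cone with apex c on the faces contained in R.  The dominators lie outside
    bad, so the vertices of bad can be deleted in any order. *)
Record dominated_cone K R bad (phi : V -> V) c : Prop := DominatedCone {
  apex_in : c \in R :\: bad;
  bad_sub : bad \subset R;
  dominator_in : forall v, v \in bad -> phi v \in R :\: bad;
  dominated : forall v F, v \in bad -> F \in K -> F \subset R -> v \in F ->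
    phi v |: F \in K;
  apex_cone : forall F, F \in K -> F \subset R :\: bad -> c |: F \in K
}.

(** The form in which both algebraic conclusions use a dominated cone: a property
    of vertex sets holds as soon as it holds for cones and can be transferred
    from R minus a dominated vertex to R. *)
Lemma dominated_cone_ind K (Q : {set V} -> Prop) :
  (forall R c, c \in R ->
     (forall F, F \in K -> F \subset R -> c |: F \in K) -> Q R) ->
  (forall R v w, v \in R -> w \in R -> v != w ->
     (forall F, F \in K -> F \subset R -> v \in F -> w |: F \in K) ->
     Q (R :\ v) -> Q R) ->
  forall R bad phi c, dominated_cone K R bad phi c -> Q R.
Proof.
move=> Qcone Qdom R bad phi c; have [n] := ubnP #|bad|.
elim: n R bad phi c => // n IHn R bad phi c le_bad dc.
have [bad0|[v bv]] := set_0Vmem bad.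
  have := apex_in dc; rewrite bad0 finset.setD0 => cR.
  apply: (Qcone R c) => // F KF sFR.
  by apply: (apex_cone dc); rewrite ?bad0 ?finset.setD0.
have Rv : v \in R := fintype.subsetP (bad_sub dc) v bv.
have /setDP[Rw Nbw] := dominator_in dc bv.
have nvw : v != phi v by apply: contraNneq Nbw => <-.
apply: (Qdom R v (phi v)) => //; first by move=> F KF sFR vF; exact: (dominated dc).
have sDR : R :\ v \subset R by rewrite subsetDl.
have defD : (R :\ v) :\: (bad :\ v) = R :\: bad.
  by apply/finset.setP=> x; rewrite !inE; case: eqP => [->|]; rewrite ?bv.
apply: (IHn _ (bad :\ v) phi c); first by move: le_bad; rewrite (cardsD1 v) bv.
split; rewrite ?defD.
- exact: apex_in dc.
- exact: finset.setSD (bad_sub dc).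
- by move=> x /setD1P[_ bx]; exact: (dominator_in dc).
- move=> x F /setD1P[_ bx] KF sF xF; apply: (dominated dc) => //.
  exact: fintype.subset_trans sF sDR.
- exact: apex_cone dc.
Qed.

End DominatedCone.

(** * Acyclicity in simplicial homology *)

Section SimplicialHomology.
Variables (k : fieldType) (V : finType).
Implicit Types (K : {set {set V}}) (R F G : {set V}) (u v w : V).
Implicit Types (x y z : {set V} -> k) (c : nat).

Definition position_sign v F : k :=
  (-1) ^+ #|[set u in F | (enum_rank u < enum_rank v)%N]%SET|.

(** In the exterior algebra on the vertices, contraction by the functional that
    is 1 on every vertex. *)
Definition boundary z F : k :=
  \sum_(v | v \notin F) position_sign v F * z (v |: F).

(** In the exterior algebra, multiplication by w on the left. *)
Definition cone_over w z F : k :=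
  if w \in F then position_sign w F * z (F :\ w) else 0.

Lemma position_signU1 v F : position_sign v (v |: F) = position_sign v F.
Proof.
congr (_ ^+ #|pred_of_set _|); apply/finset.setP=> u; rewrite !inE.
by case: eqP => [->|//]; rewrite ltnn !andbF.
Qed.

(** Adding w to a face shifts the vertices after w by one position. *)
Lemma position_signU v w F : w \notin F ->
  position_sign v (w |: F) =
  (-1) ^+ (enum_rank w < enum_rank v)%N * position_sign v F.
Proof.
move=> Fw; rewrite /position_sign -exprD; congr (_ ^+ _).
set A := [set u in F | _]%SET.
have [lt_wv|ge_wv] := boolP (enum_rank w < enum_rank v)%N.
  rewrite -[RHS](_ : #|w |: A| = _); last by rewrite cardsU1 inE (negbTE Fw).
  congr #|pred_of_set _|; apply/finset.setP=> u; rewrite !inE.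
  by case: eqP => [->|//]; rewrite lt_wv.
congr #|pred_of_set _|; apply/finset.setP=> u; rewrite !inE.
by case: eqP => [->|//]; rewrite (negbTE ge_wv) (negbTE Fw).
Qed.

Lemma position_sign_sq v F : position_sign v F * position_sign v F = 1.
Proof. by rewrite -expr2 sqrr_sign. Qed.

Lemma sign_ltn_swap v w : v != w ->
  (-1) ^+ (enum_rank v < enum_rank w)%N =
  - (-1) ^+ (enum_rank w < enum_rank v)%N :> k.
Proof.
move=> nvw; have : enum_rank v != enum_rank w by rewrite (inj_eq enum_rank_inj).
rewrite -(inj_eq val_inj) neq_ltn /=.
by case: ltngtP => //= _; rewrite ?expr0 ?expr1 ?opprK.
Qed.

(** Coning with apex w is a homotopy from the identity to 0 on the chains of the
    full simplex: contraction and left multiplication anticommute up to the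
    value of the functional at w, which is 1. *)
Lemma boundary_cone_over w z F :
  boundary (cone_over w z) F + cone_over w (boundary z) F = z F.
Proof.
rewrite /boundary /cone_over; case: ifPn => [Fw|Fw]; last first.
  rewrite addr0 (bigD1 w) //= setU11 setU1K // big1 => [|v /andP[_ nvw]].
    by rewrite addr0 position_signU1 mulrA position_sign_sq mul1r.
  by rewrite !inE eq_sym (negbTE nvw) (negbTE Fw) mulr0.
have [G Gw ->] : exists2 G : {set V}, w \notin G & F = w |: G.
  by exists (F :\ w); rewrite ?setD11 // finset.setD1K.
rewrite setU1K // [X in _ + _ * X](bigD1 w) //= mulrDr.
rewrite position_signU1 mulrA position_sign_sq mul1r addrCA -[RHS]addr0.
congr (_ + _); rewrite mulr_sumr.
have -> : \sum_(v | v \notin w |: G) position_sign v (w |: G) *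
      (if w \in v |: (w |: G)
       then position_sign w (v |: (w |: G)) * z ((v |: (w |: G)) :\ w) else 0) =
    \sum_(v | (v \notin G) && (v != w)) position_sign v (w |: G) *
       (position_sign w (v |: (w |: G)) * z (v |: G)).
  apply: eq_big => [v|v]; first by rewrite !inE negb_or andbC.
  rewrite !inE negb_or eqxx orbT => /andP[nvw _]; congr (_ * (_ * z _)).
  apply/finset.setP=> u; rewrite !inE; case: (eqVneq u w) => //= ->.
  by rewrite eq_sym (negbTE nvw) (negbTE Gw).
rewrite -big_split big1 //= => v /andP[Gv nvw].
rewrite finset.setUCA position_signU1 !position_signU // (sign_ltn_swap nvw).
set e := (-1) ^+ _; set p := position_sign v G; set q := position_sign w G.
transitivity ((1 - e * e) * (p * q * z (v |: G))); first by ring.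
by rewrite -expr2 sqrr_sign subrr mul0r.
Qed.

(** The sum is split by the order of u and v before cancelling, because
    equality with its own opposite is no information in characteristic 2. *)
Lemma sum_antisymmetric (a : V -> V -> k) :
  (forall u v, u != v -> a u v = - a v u) ->
  \sum_u \sum_(v | v != u) a u v = 0.
Proof.
move=> anti.
have split u : \sum_(v | v != u) a u v =
    \sum_(v | (enum_rank v < enum_rank u)%N) a u v -
    \sum_(v | (enum_rank u < enum_rank v)%N) a v u.
  rewrite (bigID (fun v => (enum_rank v < enum_rank u)%N)) /= -sumrN.
  congr (_ + _); apply: eq_big => v //.
  - by rewrite andbC; case: eqP => [->|]; rewrite ?ltnn ?andbT.
  - rewrite -leqNgt leq_eqVlt (inj_eq val_inj) (inj_eq enum_rank_inj) eq_sym.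
    by case: eqP => [->|] /=; rewrite ?ltnn.
  by case/andP=> nvu _; rewrite anti // eq_sym.
rewrite (eq_bigr _ (fun u _ => split u)) big_split /= sumrN.
apply/eqP; rewrite subr_eq0; apply/eqP.
rewrite (exchange_big_dep predT) //=.
Qed.

Lemma boundary_boundary z F : boundary (boundary z) F = 0.
Proof.
pose a v u := if (v \in F) || (u \in F) then 0 else
  position_sign v F * (position_sign u (v |: F) * z (u |: (v |: F))).
rewrite -[RHS](@sum_antisymmetric a) => [|u v nuv]; last first.
  rewrite /a orbC; case: ifPn => [|/norP[Fv Fu]]; first by rewrite oppr0.
  rewrite !position_signU // (sign_ltn_swap nuv) finset.setUCA.
  move: ((-1) ^+ _) (position_sign u F) (position_sign v F) (z _) => e p q r.
  by ring.
rewrite /boundary [RHS](bigID (fun v => v \in F)) /=.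
rewrite [X in _ = X + _]big1 ?add0r => [|v Fv]; last first.
  by apply: big1 => u _; rewrite /a Fv.
apply: eq_bigr => v Fv; rewrite mulr_sumr [RHS](bigID (fun u => u \in F)) /=.
rewrite [X in _ = X + _]big1 ?add0r => [|u /andP[_ Fu]]; last by rewrite /a Fu orbT.
apply: eq_big => u; first by rewrite !inE negb_or.
by rewrite !inE negb_or => /andP[_ Fu]; rewrite /a (negbTE Fv) (negbTE Fu).
Qed.

Lemma boundaryD y z : boundary (fun F => y F + z F) =
  (fun F => boundary y F + boundary z F).
Proof.
apply/funext=> F; rewrite /boundary -big_split; apply: eq_bigr => v _.
by rewrite mulrDr.
Qed.

Lemma boundaryN z : boundary (fun F => - z F) = (fun F => - boundary z F).
Proof.
apply/funext=> F; rewrite /boundary -sumrN; apply: eq_bigr => v _.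
by rewrite mulrN.
Qed.

Definition chain_of K c z : Prop :=
  forall F, z F != 0 -> F \in K /\ #|F| = c.

(** Stated on chains of faces of cardinality c, so that degree -1, spanned by the
    empty face, is included. *)
Definition acyclic K : Prop :=
  forall c z, chain_of K c z -> (forall F, boundary z F = 0) ->
  exists2 y, chain_of K c.+1 y & boundary y = z.

Lemma chain_of_boundary K c z : simplicial_complex K ->
  chain_of K c.+1 z -> chain_of K c (boundary z).
Proof.
move=> cK Kz F nz.
have [[v Fv nzv]|no] := pselect (exists2 v, v \notin F & z (v |: F) != 0).
  have [KF] := Kz _ nzv; rewrite cardsU1 Fv => -[<-].
  by split=> //; apply: cK KF _; exact: finset.subsetUr.
case/eqP: nz; apply: big1 => v Fv.
by have [->|nzv] := eqVneq (z (v |: F)) 0; [rewrite mulr0 | case: no; exists v].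
Qed.

Lemma chain_of_cone_over K c w z : 
  (forall F, z F != 0 -> w |: F \in K /\ #|F| = c) -> 
  chain_of K c.+1 (cone_over w z).
Proof.
move=> Kz F; rewrite /cone_over; case: ifP => [wF nz|]; last by rewrite eqxx.
have /Kz[] : z (F :\ w) != 0 by apply: contraNneq nz => ->; rewrite mulr0.
by rewrite finset.setD1K // (cardsD1 w F) wF => -> ->.
Qed.

Lemma restriction_complex K R : simplicial_complex K ->
  simplicial_complex (restriction K R).
Proof.
move=> cK F G; rewrite !inE => /andP[KF sFR] sGF.
by rewrite (cK F) //= (fintype.subset_trans sGF).
Qed.

(** If w dominates v and q is the part of a cycle z involving v, then the cone
    with apex w over q is a chain of the complex, and z - boundary (cone_over w q)
    no longer involves v: on faces containing v the boundaries of q and z agree,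
    and the latter vanishes. *)
Lemma dominated_cone_acyclic K R bad phi v0 : simplicial_complex K ->
  dominated_cone K R bad phi v0 -> acyclic (restriction K R).
Proof.
move=> cK; move: R bad phi v0; apply: dominated_cone_ind.
  move=> R w wR coneR c z Kz bz; exists (cone_over w z).
    apply: chain_of_cone_over => F /Kz[]; rewrite !inE => /andP[KF sFR] cF.
    by rewrite coneR // finset.subUset finset.sub1set wR.
  apply/funext=> F; rewrite -[RHS](boundary_cone_over w).
  rewrite [X in _ + X](_ : _ = 0) ?addr0 //.
  by rewrite /cone_over bz mulr0 if_same.
move=> R v w vR wR nvw dom IH c z Kz bz.
pose q F := if v \in F then z F else 0.
have Kq : chain_of (restriction K R) c.+1 (cone_over w q).
  apply: chain_of_cone_over => F; rewrite /q; case: ifP => [vF|]; last by rewrite eqxx.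
  move=> /Kz[]; rewrite !inE => /andP[KF sFR] cF.
  by rewrite dom // finset.subUset finset.sub1set wR.
have Kz' : chain_of (restriction K R) c (fun F => z F - boundary (cone_over w q) F).
  move=> F nz; have [z0|] := eqVneq (z F) 0; last exact: Kz.
  apply: (chain_of_boundary (restriction_complex cK) Kq).
  by move: nz; rewrite z0 sub0r oppr_eq0.
have [] := IH c (fun F => z F - boundary (cone_over w q) F).
- move=> F nz; have [] := Kz' F nz; rewrite !inE => /andP[-> sFR] cF; split=> //=.
  rewrite subsetD1 sFR /=; apply: contra_neqN nz => vF.
  have -> : boundary (cone_over w q) F = q F - cone_over w (boundary q) F.
    by rewrite -[in RHS](boundary_cone_over w q) addrK.
  rewrite /q vF opprB addrCA subrr addr0 /cone_over; case: ifP => // wF.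
  rewrite -[RHS](mulr0 (position_sign w F)) -(bz (F :\ w)); congr (_ * _).
  by apply: eq_bigr => u _; rewrite !inE nvw vF orbT.
- move=> F; rewrite (boundaryD z (fun F => - boundary (cone_over w q) F)).
  by rewrite boundaryN boundary_boundary bz subr0.
move=> y Ky bdy; exists (fun F => y F + cone_over w q F).
  move=> F nz; have [y0|/Ky[]] := eqVneq (y F) 0.
    by apply: Kq; move: nz; rewrite y0 add0r.
  by rewrite !inE => /andP[-> /fintype.subset_trans->] //; exact: subsetDl.
by rewrite boundaryD bdy; apply/funext=> F; rewrite subrK.
Qed.

(** Row vectors indexed by the subsets of V are read as functions on them. *)
Lemma mul_boundary_mx (x : 'rV[k]_#|{set V}|) F :
  (x *m boundary_mx k V) 0 (enum_rank F) = boundary (fun G => x 0 (enum_rank G)) F.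
Proof.
rewrite mxE (reindex _ (onW_bij _ (@enum_rank_bij _))) /= /boundary.
under eq_bigr do rewrite mxE !enum_rankK mulr_sumr.
rewrite (exchange_big_dep predT) //= [RHS]big_mkcond; apply: eq_bigr => v _.
case: ifPn => [Fv|Fv]; last first.
  rewrite big_pred0 // => G; apply/negbTE; apply: contra Fv => /andP[_ /eqP->].
  by rewrite setD11.
rewrite (big_pred1 (v |: F)) => [|G].
  by rewrite mulrC -position_signU1.
apply/andP/eqP => [[vG /eqP->]|->]; first by rewrite finset.setD1K.
by rewrite setU11 setU1K.
Qed.

Lemma acyclic_reduced_homology K c : acyclic K -> reduced_homology_dim k K c = 0%N.
Proof.
move=> aK; apply: quotient_dim_eq0; apply/rV_subP=> x.
rewrite sub_capmx => /andP[/sub_coord_mx Kx /sub_kermxP bx].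
have [|F|y Ky bdy] := aK c (fun F => x 0 (enum_rank F)).
- move=> F; rewrite -Kx mul_coord_mx enum_rankK; case: ifP; last by rewrite eqxx.
  by case/andP=> -> /eqP.
- by rewrite -mul_boundary_mx bx mxE.
apply/submxP; exists (\row_s y (enum_val s)); apply/rowP=> s.
rewrite mulmxA -[s]enum_valK mul_boundary_mx.
rewrite -[LHS](congr1 (fun f => f (enum_val s)) bdy) /=.
congr boundary; apply/funext=> F; rewrite mul_coord_mx mxE !enum_rankK.
case: ifPn => // /negP KF; have [//|nz] := eqVneq (y F) 0.
by case: KF; have [-> ->] := Ky F nz; rewrite eqxx.
Qed.

End SimplicialHomology.

(** * Exactness of a quotient complex *)

Section BasedComplexes.
Variables (k : fieldType) (r : nat -> nat).
Variable D : forall i, 'M[k]_(r i.+1, r i).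
Hypothesis D0 : D 0 = 0.
Implicit Types P : forall i, 'M[k]_(r i).

(** Exactness in all positive degrees of the complex on the subspaces P, whose
    differential is D followed by projection to P.  There is no term below degree
    0, hence no condition there. *)
Definition exact_on P : Prop := forall i (v : 'rV_(r i.+1)),
  v *m P i.+1 = v -> v *m D i *m P i = 0 ->
  exists2 w : 'rV_(r i.+2), w *m P i.+2 = w & w *m D i.+1 *m P i.+1 = v.

(** The coordinates of P split into those of a subcomplex (Q1, which D does not
    leave) and those of the quotient (Q2).  A cycle v of the quotient has its
    boundary in the subcomplex; this boundary is a cycle there, hence the boundary
    of some u' in the subcomplex, and v - u' is a cycle of P, hence a boundary. *)
Lemma exact_on_quotient (Q1 Q2 : forall i, pred 'I_(r i)) P :
  (forall i, P i = coord_mx k (Q1 i) + coord_mx k (Q2 i)) ->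
  (forall i j, ~~ (Q1 i j && Q2 i j)) ->
  (forall i, coord_mx k (Q1 i.+1) *m D i *m coord_mx k (Q2 i) = 0) ->
  (forall i, P i.+2 *m D i.+1 *m P i.+1 *m D i *m P i = 0) ->
  exact_on (fun i => coord_mx k (Q1 i)) -> exact_on P ->
  exact_on (fun i => coord_mx k (Q2 i)).
Proof.
set P1 := fun i => coord_mx k (Q1 i); set P2 := fun i => coord_mx k (Q2 i).
move=> defP Q12 P1DP2 PDPDP exP1 exP.
have P11 i : P1 i *m P1 i = P1 i by exact: coord_mx_id.
have P22 i : P2 i *m P2 i = P2 i by exact: coord_mx_id.
have P12 i : P1 i *m P2 i = 0.
  by rewrite mul_coord_coord coord_mx_pred0 // => j; apply/negbTE/Q12.
have P21 i : P2 i *m P1 i = 0.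
  by rewrite mul_coord_coord coord_mx_pred0 // => j; rewrite /= andbC; apply/negbTE/Q12.
have PP1 i : P i *m P1 i = P1 i by rewrite defP mulmxDl P11 P21 addr0.
have PP2 i : P i *m P2 i = P2 i by rewrite defP mulmxDl P22 P12 add0r.
have P1P i : P1 i *m P i = P1 i by rewrite defP mulmxDr P11 P12 addr0.
have P2P i : P2 i *m P i = P2 i by rewrite defP mulmxDr P22 P21 add0r.
move=> i v vP2 vDP2.
have vP : v *m P i.+1 = v by rewrite -vP2 -mulmxA P2P.
have defu : v *m D i *m P i = v *m D i *m P1 i by rewrite defP mulmxDr vDP2 addr0.
have [u' u'P1 u'DP1] : exists2 u' : 'rV_(r i.+1), u' *m P1 i.+1 = u' &
    u' *m D i *m P1 i = v *m D i *m P1 i.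
  case: i v vP2 vDP2 vP defu => [|i] v vP2 vDP2 vP defu.
    by exists 0; rewrite ?D0 ?mulmx0 !mul0mx.
  have [||u u1 u2] := exP1 i (v *m D i.+1 *m P1 i.+1); last by exists u.
    by rewrite -mulmxA P11.
  rewrite -defu -(PP1 i) mulmxA -vP.
  have := congr1 (mulmx v) (PDPDP i); rewrite !mulmxA mulmx0 => ->.
  by rewrite mul0mx.
have [||w wP wDP] := exP i (v - u').
- by rewrite mulmxBl vP -u'P1 -mulmxA P1P.
- rewrite !mulmxBl defu -u'DP1 defP mulmxDr -[X in _ - (_ + X *m _ *m _)]u'P1.
  rewrite -[X in _ - (_ + X)]mulmxA -[X in _ - (_ + X)]mulmxA [P1 _ *m _]mulmxA.
  by rewrite P1DP2 mulmx0 addr0 subrr.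
exists (w *m P2 i.+2); first by rewrite -mulmxA P22.
have -> : w *m P2 i.+2 = w - w *m P1 i.+2.
  by rewrite -[X in X - _]wP defP mulmxDr addrC addKr.
rewrite !mulmxBl -[w *m P1 _ *m _ *m _]mulmxA -[w *m P1 _ *m _]mulmxA.
rewrite [P1 _ *m _]mulmxA P1DP2 mulmx0 subr0.
by rewrite -(PP2 i.+1) mulmxA wDP mulmxBl vP2 -u'P1 -mulmxA P12 mulmx0 subr0.
Qed.

End BasedComplexes.

(** * Homogeneous matrices over a polynomial ring *)

Section HomogeneousMatrices.
Variables (k : fieldType) (n : nat).
Local Notation S := (mpoly n k).
Implicit Types (a b : multinom n) (f : S).

(** A homogeneous polynomial with respect to the fine grading is a scalar times a
    known monomial; setting all variables to 1 recovers the scalar. *)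
Definition dehomogenize f : k := meval (fun _ => 1) f.

HB.instance Definition _ :=
  GRing.RMorphism.copy dehomogenize (meval (fun=> 1 : k)).

Lemma dehomogenizeZX c a : dehomogenize (c *: mpolyX k a) = c.
Proof.
by rewrite /dehomogenize mevalZ mevalX big1 ?mulr1 // => i _; rewrite expr1n.
Qed.

Lemma homog_monomial a b f : mhomog_from_to a b f ->
  f = dehomogenize f *: mpolyX k (mnm_sub b a).
Proof.
move=> hf; have deff : f = mcoeff (mnm_sub b a) f *: mpolyX k (mnm_sub b a).
  apply/mpolyP=> m; rewrite mcoeffZ mcoeffX.
  case: eqVneq => [->|nm]; first by rewrite mulr1.
  rewrite mulr0; apply: memN_msupp_eq0; apply: contra_neqN nm => /hf <-.
  by rewrite addmK.
by rewrite [in LHS]deff [in dehomogenize f]deff dehomogenizeZX.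
Qed.

Lemma homog_le a b f : mhomog_from_to a b f -> dehomogenize f != 0 -> lem a b.
Proof.
move=> hf; apply: contraNT => Nle; rewrite /dehomogenize mevalE big_seq big1 //.
by move=> m /hf eb; rewrite -eb lem_addl in Nle.
Qed.

Lemma mcoeffMX_notle f a b : ~~ lem a b -> mcoeff b (f * mpolyX k a) = 0.
Proof.
move=> Nle; apply: memN_msupp_eq0; rewrite (perm_mem (msuppMX _ _)).
by apply: contra Nle => /mapP[m _ ->]; exact: lem_addr.
Qed.

End HomogeneousMatrices.

Section Homogenize.
Variables (k : fieldType) (n : nat) (b : multinom n).
Local Notation S := (mpoly n k).

(** Over k, row vectors supported on the basis elements of degree at most b are
    the same as elements of degree b of the graded free module with these basis
    elements.  [homogenize] and [degree_part] are the two directions; the second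
    also discards the components of other degrees. *)
Definition homogenize p (dr : 'I_p -> multinom n) (v : 'rV[k]_p) : 'rV[S]_p :=
  \row_j (if lem (dr j) b then v 0 j *: mpolyX k (mnm_sub b (dr j)) else 0).

Definition degree_part p (dr : 'I_p -> multinom n) (w : 'rV[S]_p) : 'rV[k]_p :=
  \row_j (if lem (dr j) b then mcoeff (mnm_sub b (dr j)) (w 0 j) else 0).

Lemma homogenizeK p (dr : 'I_p -> multinom n) (v : 'rV[k]_p) :
  degree_part dr (homogenize dr v) = v *m coord_mx k (fun j => lem (dr j) b).
Proof.
apply/rowP=> j; rewrite mul_coord_mx !mxE; case: ifP => // lejb.
by rewrite lejb mcoeffZ mcoeffX eqxx mulr1.
Qed.

Lemma degree_part_le p (dr : 'I_p -> multinom n) (w : 'rV[S]_p) :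
  degree_part dr w *m coord_mx k (fun j => lem (dr j) b) = degree_part dr w.
Proof. by apply/rowP=> j; rewrite mul_coord_mx !mxE; case: ifP => // ->. Qed.

Variables (p q : nat) (dr : 'I_p -> multinom n) (dc : 'I_q -> multinom n).
Variable M : 'M[S]_(p, q).
Hypothesis homogM : forall j l, mhomog_from_to (dc l) (dr j) (M j l).
Let N := map_mx (@dehomogenize k n) M.

Let subm_chain j l : lem (dr j) b -> lem (dc l) (dr j) ->
  mnm_sub b (dc l) = mnm_add (mnm_sub (dr j) (dc l)) (mnm_sub b (dr j)).
Proof.
move=> /mnm_lepP lejb /mnm_lepP lelj; apply/mnmP=> i; rewrite mnmDE !mnmBE.
by rewrite addnC addnBA // subnK.
Qed.

(** A homogeneous matrix and its dehomogenization act in the same way through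
    the correspondence. *)
Lemma homogenize_mul v :
  homogenize dr v *m M =
  homogenize dc (v *m coord_mx k (fun j => lem (dr j) b) *m N).
Proof.
apply/rowP=> l; rewrite !mxE; under eq_bigr do rewrite mxE.
under [X in if _ then X *: _ else _]eq_bigr do rewrite mul_coord_mx mxE.
case: ifPn => [lelb|Nlelb]; last first.
  apply: big1 => j _; case: ifP => [lejb|]; last by rewrite mul0r.
  have [M0|nz] := eqVneq (dehomogenize (M j l)) 0.
    by rewrite (homog_monomial (@homogM j l)) M0 scale0r mulr0.
  by case/negP: Nlelb; exact: lepm_trans (homog_le (@homogM j l) nz) lejb.
rewrite scaler_suml; apply: eq_bigr => j _.
case: ifP => lejb; last by rewrite !mul0r scale0r.
rewrite {1}(homog_monomial (@homogM j l)).
have [->|nz] := eqVneq (dehomogenize (M j l)) 0.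
  by rewrite scale0r !mulr0 scale0r.
rewrite (subm_chain lejb (homog_le (@homogM j l) nz)) mpolyXD.
by rewrite -scalerAl -scalerAr scalerA [X in _ *: X]mulrC.
Qed.

Lemma degree_part_mul (w : 'rV[S]_p) :
  degree_part dc (w *m M) = degree_part dr w *m N.
Proof.
apply/rowP=> l; rewrite !mxE; under [RHS]eq_bigr do rewrite !mxE.
case: ifPn => [lelb|Nlelb]; last first.
  rewrite big1 // => j _; case: ifP => [lejb|]; last by rewrite mul0r.
  have [->|nz] := eqVneq (dehomogenize (M j l)) 0; first by rewrite mulr0.
  by case/negP: Nlelb; exact: lepm_trans (homog_le (@homogM j l) nz) lejb.
rewrite raddf_sum; apply: eq_bigr => j _ /=.
rewrite {1}(homog_monomial (@homogM j l)) -scalerAr mcoeffZ mulrC.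
have [->|nz] := eqVneq (dehomogenize (M j l)) 0; first by rewrite !mulr0.
congr (_ * _); have lelj := homog_le (@homogM j l) nz.
case: ifPn => [lejb|Nlejb]; first by rewrite (subm_chain lejb lelj) mcoeffMX.
apply: mcoeffMX_notle; apply: contra Nlejb => /mnm_lepP le1; apply/mnm_lepP=> i.
move/mnm_lepP/(_ i): lelj; move/mnm_lepP/(_ i): lelb; move: (le1 i).
by rewrite !mnmBE => *; rewrite -(leq_sub2rE (p := dc l i)).
Qed.

End Homogenize.

(** * Multigraded Tor *)

Section AugmentedResolution.
Variables (k : fieldType) (V : finType) (I : set (mpoly #|V| k)).
Variable F : free_resolution I.
Local Notation S := (mpoly #|V| k).
Implicit Types (B C R X : {set V}) (v w : V) (a : multinom #|V|).

(** The augmented resolution F_1 -> F_0 -> S -> 0 shifted up by two: F_i sits in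
    level i + 2, S in level 1 with one basis element of degree 0, and level 0 is
    zero.  This makes exactness at S and at F_0 instances of exactness at a
    positive level. *)
Definition level_rk i : nat :=
  match i with 0 => 0 | 1 => 1 | i.+2 => rk F i end.

Definition level_mdeg i : 'I_(level_rk i) -> multinom #|V| :=
  match i return 'I_(level_rk i) -> multinom #|V| with
  | 0 | 1 => fun=> mnm0
  | i.+2 => @mdeg_of _ _ _ F i
  end.

Definition level_diff i : 'M[S]_(level_rk i.+1, level_rk i) :=
  match i return 'M[S]_(level_rk i.+1, level_rk i) with
  | 0 => 0
  | 1 => aug F
  | i.+2 => Defs.diff F i
  end.

Definition level_mx i : 'M[k]_(level_rk i.+1, level_rk i) :=
  map_mx (@dehomogenize k #|V|) (level_diff i).

Definition nonface B : Prop := I (face_monomial k B).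

Definition above C i (j : 'I_(level_rk i)) : bool :=
  lem (support_mnm C) (level_mdeg j).

(** The basis element of S counts as below B when the monomial of B is in I: in
    degree B the augmentation has image I_B, which is k or 0, and with this
    convention the augmented strand is exact at S as well. *)
Definition below B i : pred 'I_(level_rk i) :=
  match i return pred 'I_(level_rk i) with
  | 0 | 1 => fun=> `[< nonface B >]
  | i.+2 => fun j => lem (@level_mdeg i.+2 j) (support_mnm B)
  end.

Definition interval C B i : pred 'I_(level_rk i) :=
  fun j => above C j && below B j.

Definition exact_between C B : Prop :=
  exact_on level_mx (fun i => coord_mx k (@interval C B i)).

Lemma level_homog i j l :
  mhomog_from_to (level_mdeg l) (level_mdeg j) (level_diff i j l).
Proof.
case: i j l => [|[|i]] j l.
- by case: l.
- by rewrite [l]ord1; exact: aug_homog.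
- exact: diff_homog.
Qed.

(** Exactness at S is not included: there the image of the augmentation is I. *)
Lemma level_exact i (v : 'rV[S]_(level_rk i.+2)) :
  v *m level_diff i.+1 = 0 <->
  exists w : 'rV[S]_(level_rk i.+3), v = w *m level_diff i.+2.
Proof. by case: i v => [|i] v; [exact: exact_aug | exact: exact_diff]. Qed.

Lemma level_mx_le i j l : level_mx i j l != 0 -> lem (level_mdeg l) (level_mdeg j).
Proof. by rewrite mxE; exact: homog_le (@level_homog i j l). Qed.

Lemma level_mx_sq i : level_mx i.+1 *m level_mx i = 0.
Proof.
case: i => [|i].
  by rewrite [level_mx 0](_ : _ = 0) ?mulmx0 //; apply/matrixP=> i [].
rewrite -map_mxM [_ *m _](_ : _ = 0) ?map_mx0 //; apply/row_matrixP=> j.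
by rewrite row_mul row0; apply/level_exact; exists (delta_mx 0 j); rewrite rowE.
Qed.

Lemma face_monomialE B : face_monomial k B = mpolyX k (support_mnm B).
Proof.
rewrite /face_monomial mprodXE; congr mpolyX; apply/mnmP=> i.
rewrite mnm_sumE mnmE big_mkcond (bigD1 (enum_val i)) //= big1 ?addn0 => [|v nv].
  by case: ifP => // _; rewrite mnm1E enum_valK eqxx.
case: ifP => // _; rewrite mnm1E; apply/eqP; rewrite eqb0.
by apply: contra nv => /eqP <-; rewrite enum_rankK.
Qed.

Lemma support_mnmE B v : support_mnm B (enum_rank v) = (v \in B).
Proof. by rewrite mnmE enum_rankK. Qed.

Lemma support_leP B a :
  reflect (forall v, v \in B -> (0 < a (enum_rank v))%N) (lem (support_mnm B) a).
Proof.
apply: (iffP mnm_lepP) => [le v Bv|pos i].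
  by have := le (enum_rank v); rewrite support_mnmE Bv.
by rewrite -[i]enum_valK support_mnmE; case: (boolP (_ \in B)) => // /pos.
Qed.

Lemma le_supportP B a :
  reflect (forall v, (a (enum_rank v) <= (v \in B))%N) (lem a (support_mnm B)).
Proof.
apply: (iffP mnm_lepP) => [le v|le i].
  by have := le (enum_rank v); rewrite support_mnmE.
by rewrite -[i]enum_valK support_mnmE.
Qed.

Definition involves v i (j : 'I_(level_rk i)) : bool :=
  (0 < level_mdeg j (enum_rank v))%N.

(** In the passage from level 2 to level 1, a nonzero entry of the augmentation
    exhibits a monomial of I that divides the monomial of B. *)
Lemma level_mx_below B i j l :
  level_mx i j l != 0 -> below B j -> below B l.
Proof.
case: i j l => [|[|i]] j l nz.
- by case: l nz.
- move=> lejB; apply/asboolP; apply/(aug_image F).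
  have := nz; rewrite mxE => naug.
  exists (((dehomogenize (aug F j 0))^-1 *:
            mpolyX k (mnm_sub (support_mnm B) (mdeg_of j))) *: delta_mx 0 j).
  rewrite face_monomialE -scalemxAl -rowE; apply/rowP=> t.
  rewrite [t]ord1 !mxE eqxx mulr1n.
  rewrite [in X in _ * X](homog_monomial (@aug_homog _ _ _ F j)) subm0.
  rewrite ord1 in naug.
  by rewrite -scalerAl -scalerAr scalerA mulVf // scale1r -mpolyXD submK.
- move=> lejB; exact: lepm_trans (level_mx_le nz) lejB.
Qed.

Lemma level_mx_above C i j l : level_mx i j l != 0 -> above C l -> above C j.
Proof. by move=> nz leCl; exact: lepm_trans leCl (level_mx_le nz). Qed.

(** Intervals are convex: if two successive entries of the differential are
    nonzero between basis elements in [C,B], the middle one is in [C,B]. *)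
Lemma interval_sq C B i :
  coord_mx k (@interval C B i.+2) *m level_mx i.+1 *m coord_mx k (@interval C B i.+1)
    *m level_mx i *m coord_mx k (@interval C B i) = 0.
Proof.
rewrite -[_ *m level_mx i]mulmxA -[_ *m (_ *m level_mx i)]mulmxA.
apply: coord_block_eq0 => j l /andP[_ Bj] /andP[Cl _].
have := congr1 (fun A : 'M[k]_(_, _) => A j l) (level_mx_sq i).
rewrite [X in X = _ -> _]mxE [X in _ = X -> _]mxE => <-; rewrite mxE.
apply: eq_bigr => m _.
rewrite mul_coord_mxl; case: ifPn => // Nm.
have [->|nz1] := eqVneq (level_mx i.+1 j m) 0; first by rewrite !mul0r.
have [->|nz2] := eqVneq (level_mx i m l) 0; first by rewrite !mulr0.
by case/negP: Nm; rewrite /interval (level_mx_above nz2) ?(level_mx_below nz1).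
Qed.

(** This complex is the degree B strand of the augmented resolution. *)
Lemma exact_below B : exact_between finset.set0 B.
Proof.
have above0 i (j : 'I_(level_rk i)) : above finset.set0 j.
  by apply/support_leP => v; rewrite inE.
have intE i : @interval finset.set0 B i =1 @below B i.
  by move=> j; rewrite /interval above0.
move=> i v; rewrite !(eq_coord_mx _ (intE _)); case: i v => [|i] v vB vD.
  have [IB|NIB] := pselect (nonface B); last first.
    exists 0; first by rewrite mul0mx.
    by rewrite !mul0mx -vB coord_mx_pred0 ?mulmx0 // => j /=; apply/asboolPn.
  have /(aug_image F)[u defu] := IB.
  exists (v 0 0 *: degree_part (support_mnm B) (@level_mdeg 2) u).
    by rewrite -scalemxAl degree_part_le.
  rewrite -!scalemxAl -(degree_part_mul (support_mnm B) (@level_homog 1)) -[RHS]vB.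
  apply/rowP=> j; rewrite [in LHS]mxE !mul_coord_mx /=.
  case: ifP => _; last by rewrite mulr0.
  have le0 : lem mnm0 (support_mnm B) by apply/mnm_lepP=> t; rewrite mnm0E.
  by rewrite mxE le0 defu face_monomialE subm0 (ord1 j) mxE eqxx mcoeffX eqxx mulr1.
(* The boundary of v involves only basis elements below B, so it vanishes
   everywhere once it vanishes on those. *)
have vD0 : v *m level_mx i.+1 = 0.
  apply/rowP=> l; have := congr1 (fun w : 'rV[k]_(_) => w 0 l) vD.
  rewrite mul_coord_mx; case: ifPn => // Nl _; rewrite -vB [LHS]mxE [RHS]mxE.
  apply: big1 => j _; rewrite mul_coord_mx; case: ifPn => [Bj|]; last by rewrite mul0r.
  have [->|nz] := eqVneq (level_mx i.+1 j l) 0; first by rewrite mulr0.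
  by rewrite (level_mx_below nz Bj) in Nl.
have [w defv] : exists w : 'rV[S]_(level_rk i.+3),
    homogenize (support_mnm B) (@level_mdeg i.+2) v = w *m level_diff i.+2.
  apply/level_exact; rewrite (homogenize_mul (support_mnm B) (@level_homog i.+1)).
  rewrite [v *m _]vB vD0; apply/rowP=> l; rewrite !mxE scale0r.
  by case: ifP.
exists (degree_part (support_mnm B) (@level_mdeg i.+3) w); first exact: degree_part_le.
rewrite -(degree_part_mul (support_mnm B) (@level_homog i.+2)) -defv.
by rewrite homogenizeK [v *m _]vB.
Qed.

Lemma below_setD1 B v i (j : 'I_(level_rk i.+2)) :
  below (B :\ v) j = below B j && ~~ involves v j.
Proof.
apply/le_supportP/andP => [le|[/le_supportP le]]; last first.
  rewrite /involves -eqn0Ngt => /eqP v0 u; have := le u; rewrite !inE.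
  by case: eqP => //= ->; rewrite v0.
split; last by have := le v; rewrite setD11 /involves -leqNgt.
apply/le_supportP=> u; apply: leq_trans (le u) _.
by rewrite !inE; case: eqP.
Qed.

Lemma above_setU1 C v i (j : 'I_(level_rk i)) :
  above (v |: C) j = above C j && involves v j.
Proof.
apply/support_leP/andP => [pos|[/support_leP pos posv] u].
  by split; [apply/support_leP=> u Cu|]; apply: pos; rewrite !inE ?Cu ?eqxx ?orbT.
by rewrite !inE => /predU1P[->|/pos].
Qed.

Lemma interval_setU1 C B v i :
  @interval (v |: C) B i =1 predI (@interval C B i) (@involves v i).
Proof. by move=> j; rewrite /interval /= above_setU1 andbAC. Qed.

Lemma interval_setD1 C B v i :
  C != finset.set0 \/ (nonface B <-> nonface (B :\ v)) ->
  @interval C (B :\ v) i =1 predI (@interval C B i) (predC (@involves v i)).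
Proof.
case: i => [|[|i]] hC j.
- by case: j.
- rewrite /interval /involves /= mnm0E andbT; case: hC => [|eqB]; last first.
    by congr (_ && _); apply: asbool_equiv_eq; split=> /eqB.
  case/set0Pn=> u Cu; rewrite [above C j](_ : _ = false) //.
  by apply/support_leP=> /(_ u Cu); rewrite /= mnm0E.
- by rewrite /interval below_setD1 andbA.
Qed.

(** The complex [C, B - v] is a subcomplex of [C, B] with quotient [C + v, B].
    The hypothesis ensures that the basis element of S does not end up in the
    quotient. *)
Lemma exact_setU1 C B v :
  C != finset.set0 \/ (nonface B <-> nonface (B :\ v)) ->
  exact_between C (B :\ v) -> exact_between C B -> exact_between (v |: C) B.
Proof.
move=> hC; apply: exact_on_quotient => [|i|i|i|i].
- by apply/matrixP=> i [].
- rewrite (eq_coord_mx _ (interval_setD1 hC)) (eq_coord_mx _ (@interval_setU1 C B v i)).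
  exact: coord_mxD.
- move=> j; rewrite (interval_setD1 hC) interval_setU1 /=.
  by case: involves; rewrite ?andbF.
- apply: coord_block_eq0 => j l; rewrite (interval_setD1 hC) interval_setU1 /=.
  case/andP=> _ Nj /andP[_ lv]; apply/eqP; apply: contraNT Nj => /level_mx_le/mnm_lepP.
  by move/(_ (enum_rank v)); apply: leq_trans.
- exact: interval_sq.
Qed.

Lemma exact_set1 B v : (nonface B <-> nonface (B :\ v)) ->
  exact_between [set v] B.
Proof.
move=> eqB; rewrite -[[set v]%SET]finset.setU0.
by apply: exact_setU1; [right | exact: exact_below | exact: exact_below].
Qed.

(** The elements of C other than w are inserted one at a time.  They must avoid
    X, since insertion of u also needs the interval that ends at B - u, and this
    set must still contain X. *)
Lemma exact_extend R X w :
  (forall B, w \in B -> X \subset B -> B \subset R -> exact_between [set w] B) ->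
  forall C B, w \in C -> [disjoint C & X] -> C \subset B -> X \subset B ->
    B \subset R -> exact_between C B.
Proof.
move=> base C; have [n] := ubnP #|C|; elim: n C => // n IHn C leC B wC dCX sCB sXB sBR.
have [C1|[u]] := set_0Vmem (C :\ w).
  have -> : C = [set w]%SET by rewrite -(finset.setD1K wC) C1 finset.setU0.
  by apply: base => //; exact: (fintype.subsetP sCB).
rewrite !inE => /andP[nuw uC]; rewrite -(finset.setD1K uC).
have wCu : w \in C :\ u by rewrite !inE eq_sym nuw.
have leCu : (#|C :\ u| < n)%N by move: leC; rewrite (cardsD1 u) uC.
have dCu : [disjoint C :\ u & X].
  by apply: disjointWl dCX; exact: subsetDl.
have sCuB : C :\ u \subset B := fintype.subset_trans (subsetDl _ _) sCB.
apply: exact_setU1; first by left; apply/set0Pn; exists w.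
  apply: IHn => //; first exact: finset.setSD.
  - by rewrite subsetD1 sXB; apply/negP => Xu; have := disjointFr dCX uC; rewrite Xu.
  - exact: fintype.subset_trans (subsetDl _ _) sBR.
exact: IHn.
Qed.

Lemma nonfaceE B : nonface B <-> B \notin SR_complex I.
Proof. by rewrite inE negbK; split=> [?|/asboolP]; first exact/asboolP. Qed.

Lemma exact_dominated B w : simplicial_complex (SR_complex I) ->
  (B :\ w \in SR_complex I -> B \in SR_complex I) -> exact_between [set w] B.
Proof.
move=> cI stepB; apply: exact_set1; rewrite !nonfaceE; split; first exact: contra.
by apply: contra => KB; apply: cI KB _; exact: subsetDl.
Qed.

(** When w dominates v, the sets B that contain v and w satisfy the hypothesis of
    [exact_dominated], which gives exactness of [R - v, R]; together with
    exactness of [R - v, R - v] it gives exactness of [R, R]. *)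
Lemma exact_dominated_cone R bad phi v0 :
  simplicial_complex (SR_complex I) ->
  dominated_cone (SR_complex I) R bad phi v0 -> exact_between R R.
Proof.
move=> cI; move: R bad phi v0.
apply: dominated_cone_ind => [R w wR cone|R v w vR wR nvw dom IH].
  apply: (@exact_extend R finset.set0 w);
    rewrite ?finset.sub0set -?finset.setI_eq0 ?finset.setI0 //.
  move=> B wB _ sBR; apply: exact_dominated => // KBw.
  rewrite -(finset.setD1K wB); apply: cone => //.
  exact: fintype.subset_trans (subsetDl _ _) sBR.
rewrite -[X in exact_between X _](finset.setD1K vR); apply: exact_setU1 => //.
  by left; apply/set0Pn; exists w; rewrite !inE eq_sym nvw.
apply: (@exact_extend R [set v]%SET w); rewrite ?finset.sub1set ?subsetDl //.
- move=> B wB; rewrite finset.sub1set => vB sBR.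
  apply: exact_dominated => // KBw.
  rewrite -(finset.setD1K wB); apply: dom => //; last by rewrite !inE nvw.
  exact: fintype.subset_trans (subsetDl _ _) sBR.
- by rewrite !inE eq_sym nvw.
- by rewrite disjoint_sym disjoints1 setD11.
Qed.

(** The basis elements of degree exactly R span both [R, R] and the degree R part
    of F tensored with k.  Between such elements the entries of the differential
    are constants, so taking constant terms and setting variables to 1 agree. *)
Lemma tor_exact R i : R != finset.set0 -> exact_between R R ->
  tor_dim F i (support_mnm R) = 0%N.
Proof.
move=> nR exR; apply: quotient_dim_eq0.
have PE i' : coord_mx k (@interval R R i'.+2) = tensor_part F (support_mnm R) i'.
  apply: eq_coord_mx => j; rewrite /interval /above /=.
  apply/andP/eqP => [[/mnm_lepP leRj /mnm_lepP lejR]|->]; last by rewrite lepm_refl.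
  by apply/mnmP=> t; apply/eqP; rewrite eqn_leq lejR leRj.
have diffE i' : tensor_part F (support_mnm R) i'.+1 *m level_mx i'.+2 *m
                  tensor_part F (support_mnm R) i' =
    tensor_part F (support_mnm R) i'.+1 *m tensor_diff F i'.
  apply/matrixP=> j l; rewrite mul_coord_mx !mul_coord_mxl.
  have [degj|_] := eqVneq (mdeg_of j) (support_mnm R); last by rewrite if_same.
  rewrite !mxE; case: eqP => [degl|degl].
    rewrite [in RHS](homog_monomial (@diff_homog _ _ _ F i' j l)) degl degj.
    rewrite mcoeffZ mcoeffX [mnm_sub _ _](_ : _ = mnm0) ?eqxx ?mulr1 //.
    by apply/mnmP=> t; rewrite mnmBE subnn mnm0E.
  apply/esym/memN_msupp_eq0/negP => /diff_homog; rewrite add0m degj.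
  exact: degl.
apply/rV_subP=> v; rewrite sub_capmx => /andP[/sub_coord_mx vR vker].
have [||w wR wD] := exR i.+1 v; first by rewrite PE.
  move: v vR vker; case: i => [|i] v vR vker.
    rewrite [coord_mx _ _](_ : _ = 0) ?mulmx0 //; apply: coord_mx_pred0 => j.
    rewrite /interval /above /=; apply/negbTE; rewrite negb_and; apply/orP; left.
    have [u uR] := set0Pn _ nR.
    by apply/support_leP=> /(_ u uR); rewrite mnm0E.
  rewrite PE -vR -mulmxA -mulmxA [X in _ *m X]mulmxA diffE mulmxA vR.
  exact: (sub_kermxP vker).
rewrite -wD -wR !PE -mulmxA -mulmxA [X in _ *m X]mulmxA diffE; exact: submxMl.
Qed.

Lemma tor_dominated_cone R bad phi v0 i :
  simplicial_complex (SR_complex I) ->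
  dominated_cone (SR_complex I) R bad phi v0 ->
  tor_dim F i (support_mnm R) = 0%N.
Proof.
move=> cI dc; apply: tor_exact; last exact: exact_dominated_cone dc.
by apply/set0Pn; exists v0; case/setDP: (apex_in dc).
Qed.

End AugmentedResolution.

(** * Contractibility of the realization *)

Section ConeContraction.
Variables (R : realType) (V : finType).
Implicit Types (K : {set {set V}}) (F W bad : {set V}) (phi : V -> V) (c v : V).

(** The simplicial map that moves every deleted vertex to its dominator. *)
Definition retract bad phi v := if v \in bad then phi v else v.

(** The identity and the retraction are contiguous. *)
Lemma dominated_cone_union K W bad phi c F : dominated_cone K W bad phi c ->
  F \in K -> F \subset W -> F :|: retract bad phi @: F \in K.
Proof.
move=> dc KF sFW.
have dominators s : {subset s <= F :&: bad} ->
    F :|: [set:: [seq phi v | v <- s]] \in K /\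
    F :|: [set:: [seq phi v | v <- s]] \subset W.
  elim: s => [|v s IHs] sFb.
    have -> : [set:: [seq phi v | v <- [::]]]%SET = finset.set0 :> {set V}.
      by apply/finset.setP=> u; rewrite !inE.
    by rewrite finset.setU0.
  have /setIP[Fv bv] := sFb v (mem_head _ _).
  have [Ks sW] := IHs (fun u us => sFb u (mem_behead (s := v :: s) us)).
  have -> : F :|: [set:: [seq phi v | v <- v :: s]]%SET =
            phi v |: (F :|: [set:: [seq phi v | v <- s]]%SET).
    by apply/finset.setP=> u; rewrite !inE orbCA.
  split; first by apply: (dominated dc) => //; rewrite inE Fv.
  by rewrite finset.subUset finset.sub1set sW andbT; case/setDP: (dominator_in dc bv).
have [|KU _] := dominators (enum (F :&: bad)); first by move=> u; rewrite mem_enum.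
congr (_ \in K): KU; apply/finset.setP=> u; rewrite !inE.
case Fu: (u \in F) => //=; apply/mapP/imsetP => [[v vFb ->]|[v Fv def_u]].
  move: vFb; rewrite mem_enum => /setIP[Fv bv].
  by exists v => //; rewrite /retract bv.
move: def_u; rewrite /retract; case: ifP => [bv ->|_ eq_uv];
  last by rewrite eq_uv Fv in Fu.
by exists v; rewrite // mem_enum inE Fv.
Qed.

(** The retraction and the constant map to the apex are contiguous. *)
Lemma dominated_cone_retract K W bad phi c F : simplicial_complex K ->
  dominated_cone K W bad phi c ->
  F \in K -> F \subset W -> c |: retract bad phi @: F \in K.
Proof.
move=> cK dc KF sFW; apply: (apex_cone dc).
  by apply: cK (dominated_cone_union dc KF sFW) _; exact: finset.subsetUr.
apply/fintype.subsetP=> _ /imsetP[v Fv ->]; rewrite /retract.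
case: ifPn => [bv|Nbv]; first exact: (dominator_in dc bv).
by rewrite inE Nbv (fintype.subsetP sFW).
Qed.

Lemma retract_sub K W bad phi c F : dominated_cone K W bad phi c ->
  F \subset W -> retract bad phi @: F \subset W.
Proof.
move=> dc sFW; apply/fintype.subsetP=> _ /imsetP[v Fv ->]; rewrite /retract.
case: ifPn => [bv|_]; first by case/setDP: (dominator_in dc bv).
exact: (fintype.subsetP sFW).
Qed.

(** The weights of the identity, the retraction and the constant map at time t:
    the first homotopy runs until t = 1/2, the second from then on.  The weight of
    the retraction is what remains. *)
Definition weight_id (t : R) : R := Num.max (1 - 2 * t) 0.
Definition weight_apex (t : R) : R := Num.max (2 * t - 1) 0.

Definition push_forward (psi : V -> V) (x : 'rV[R]_#|V|) v : R :=
  \sum_(u | psi u == v) x 0 (enum_rank u).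

Definition cone_homotopy (psi : V -> V) c (p : R * 'rV[R]_#|V|) : 'rV[R]_#|V| :=
  \row_i (weight_id p.1 * p.2 0 i +
          (1 - weight_id p.1 - weight_apex p.1) * push_forward psi p.2 (enum_val i) +
          weight_apex p.1 * (enum_val i == c)%:R).

Lemma continuous_row n (T : topologicalType) (f : T -> 'rV[R]_n) :
  (forall i, continuous (fun z => f z 0 i)) -> continuous f.
Proof.
move=> cf z A [P nP sPA]; rewrite /nbhs /=.
suff : \forall y \near z, forall i, P 0 i (f y 0 i).
  by apply: filterS => y Py; apply: sPA => j i; rewrite [j]ord1.
by apply: filter_forall => i; apply: (cf i z); exact: nP.
Qed.

Lemma weight_id_continuous : continuous weight_id.
Proof.
move=> t; apply: (@continuous_max R R (fun s => 1 - 2 * s) (fun=> 0) t);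
  last exact: cst_continuous.
by apply: cvgB; [exact: cvg_cst | apply: cvgM; [exact: cvg_cst | exact: cvg_id]].
Qed.

Lemma weight_apex_continuous : continuous weight_apex.
Proof.
move=> t; apply: (@continuous_max R R (fun s => 2 * s - 1) (fun=> 0) t);
  last exact: cst_continuous.
by apply: cvgB; [apply: cvgM; [exact: cvg_cst | exact: cvg_id] | exact: cvg_cst].
Qed.

Lemma cone_homotopy_continuous psi c : continuous (cone_homotopy psi c).
Proof.
apply: continuous_row => i.
rewrite (_ : (fun p => _) = (fun p : R * 'rV[R]_#|V| => weight_id p.1 * p.2 0 i +
    (1 - weight_id p.1 - weight_apex p.1) * push_forward psi p.2 (enum_val i) +
    weight_apex p.1 * (enum_val i == c)%:R)); last first.
  by apply/funext=> p; rewrite mxE.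
move=> z.
have cid : (weight_id p.1 @[p --> z] --> weight_id z.1)%classic.
  by apply: (cvg_comp _ _ (@cvg_fst _ _ _ _ _)); exact: weight_id_continuous.
have cap : (weight_apex p.1 @[p --> z] --> weight_apex z.1)%classic.
  by apply: (cvg_comp _ _ (@cvg_fst _ _ _ _ _)); exact: weight_apex_continuous.
have ccoord (j : 'I_#|V|) :
    ((fun p : R * 'rV[R]_#|V| => p.2 0 j) p @[p --> z] --> z.2 0 j)%classic.
  apply: (cvg_comp _ (fun x : 'rV[R]_#|V| => x 0 j) (@cvg_snd _ _ _ _ _)).
  exact: (@coord_continuous R 1 #|V| 0 j z.2).
apply: cvgD; last by apply: cvgM => //; exact: cvg_cst.
apply: cvgD; first exact: cvgM.
apply: cvgM; first by apply: cvgB => //; apply: cvgB => //; exact: cvg_cst.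
by apply: cvg_big => // ; exact: add_continuous.
Qed.

(** At every time one of the two outer maps has weight 0, so only two contiguous
    maps are averaged. *)
Lemma weight_ge0 t : 0 <= t <= 1 ->
  [/\ 0 <= weight_id t, 0 <= weight_apex t, 0 <= 1 - weight_id t - weight_apex t &
      weight_id t = 0 \/ weight_apex t = 0].
Proof.
case/andP=> t0 t1; rewrite /weight_id /weight_apex; rewrite !maxEle.
by do 2!case: ifPn => ?; (split; [lra|lra|lra|]);
  first [left; lra | right; lra | exfalso; lra].
Qed.

Lemma dominated_cone_contractible K W bad phi c :
  simplicial_complex K -> finset.set0 \in K -> dominated_cone K W bad phi c ->
  contractible R (restriction K W).
Proof.
move=> cK K0 dc; set psi := retract bad phi.
have /setDP[Wc Nbc] := apex_in dc.
pose x0 : 'rV[R]_#|V| := \row_i (enum_val i == c)%:R.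
exists x0, (cone_homotopy psi c); split.
- have Kc : [set c]%SET \in K.
    by rewrite -[[set c]%SET]finset.setU0; apply: (apex_cone dc) => //;
      rewrite finset.sub0set.
  split.
  + by move=> i; rewrite mxE ler0n.
  + rewrite (bigD1 (enum_rank c)) //= mxE enum_rankK eqxx big1 ?addr0 // => i nic.
    rewrite mxE; case: eqP => // eic; case/eqP: nic; rewrite -eic.
    by rewrite enum_valK.
  + rewrite inE (_ : [set _ | _]%SET = [set c]%SET) ?Kc ?finset.sub1set //.
    by apply/finset.setP=> v; rewrite !inE mxE enum_rankK;
      case: (v == c); rewrite ?oner_eq0 ?eqxx.
- by apply: continuous_subspaceT => z; exact: cone_homotopy_continuous.
- move=> t x /weight_ge0[]; set a := weight_id t; set g := weight_apex t.
  move=> a0 g0 b0 ag [x_ge0 x_sum Kx].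
  have {Kx} := Kx; set F := [set v | _]%SET; rewrite inE => /andP[KF sFW].
  have pf0 v : v \notin psi @: F -> push_forward psi x v = 0.
    move=> Nv; apply: big1 => u /eqP def_v; apply/eqP; apply: contraNT Nv => nu.
    by rewrite -def_v; apply: imset_f; rewrite inE.
  have NF v : v \notin F -> x 0 (enum_rank v) = 0 by rewrite inE negbK => /eqP.
  split.
  + move=> i; rewrite mxE /= -/a -/g !addr_ge0 // mulr_ge0 ?ler0n //.
    by apply: sumr_ge0.
  + under eq_bigr do rewrite mxE.
    rewrite !big_split /= -!mulr_sumr x_sum -/a -/g.
    have -> : \sum_(i < #|V|) push_forward psi x (enum_val i) = 1.
      have sumE (f : 'I_#|V| -> R) : \sum_i f i = \sum_v f (enum_rank v).
        by apply: reindex; exact/onW_bij/enum_rank_bij.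
      rewrite -x_sum !sumE.
      under eq_bigr do rewrite enum_rankK.
      by rewrite [in RHS](partition_big psi predT).
    rewrite (bigD1 (enum_rank c)) //= enum_rankK eqxx big1 => [|i nic];
      first by rewrite /=; ring.
    by case: eqP => // eic; case/eqP: nic; rewrite -eic enum_valK.
  + rewrite inE; set G := [set v | _]%SET.
    have sub : (G \subset F :|: psi @: F) || (G \subset c |: psi @: F).
      case: ag => [a_eq0|g_eq0]; apply/orP; [right|left]; apply/fintype.subsetP=> v;
        rewrite inE mxE enum_rankK /= -/a -/g; apply: contraR; rewrite !inE negb_or.
      * by case/andP=> /negbTE-> /pf0->; rewrite a_eq0 mul0r !mulr0 !addr0.
      * by case/andP=> Nv /pf0->; rewrite g_eq0 NF ?inE // mul0r !mulr0 !addr0.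
    case/orP: sub => sG; rewrite (cK _ _ _ sG) ?(fintype.subset_trans sG) //.
    * by rewrite finset.subUset sFW (retract_sub dc).
    * exact: (dominated_cone_union dc).
    * by rewrite finset.subUset finset.sub1set Wc (retract_sub dc).
    * exact: (dominated_cone_retract cK dc).
- move=> x _; apply/rowP=> i; rewrite mxE /= /weight_id /weight_apex mulr0 subr0 sub0r.
  rewrite (max_idPl ler01) (max_idPr _) ?oppr_le0 ?ler01 //.
  by rewrite subrr subr0 !mul0r !addr0 mul1r.
- move=> x _; apply/rowP=> i; rewrite !mxE /= /weight_id /weight_apex mulr1.
  have -> : (1 - 2 : R) = -1 by ring.
  have -> : (2 - 1 : R) = 1 by ring.
  rewrite (max_idPl ler01) (max_idPr _) ?oppr_le0 ?ler01 //.
  by rewrite subr0 subrr !mul0r !add0r mul1r.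
Qed.

End ConeContraction.

(** * Letterplace ideals *)

Section LetterplaceComplexes.
Variables (k : fieldType) (d : Order.disp_t) (P : finPOrderType d).
Local Notation V := ('I_2 * P)%type.
Implicit Types F : {set V}.

(** A face monomial without comparable pair is not in the ideal: at the indicator
    of the face it takes the value 1, while every generator vanishes. *)
Lemma Delta2P F : F \in Delta2 k P <->
  forall p q, (ord0, p) \in F -> (ord_max, q) \in F -> ~~ (p <= q)%O.
Proof.
split=> [KF p q Fp Fq|antiF].
  apply/negP => le_pq.
  have : [set (ord0, p); (ord_max, q)]%SET \in Delta2 k P.
    apply: Delta2_complex KF _; rewrite finset.subUset !finset.sub1set.
    by rewrite Fp.
  rewrite inE => /asboolP; apply.
  exists [:: (1, face_monomial k [set (ord0, p); (ord_max, q)]%SET)]; split.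
    move=> _ /[!inE]/eqP-> /=; exists p, q; split=> //.
    by rewrite /face_monomial finset.big_setU1 ?inE //= finset.big_set1.
  by rewrite big_seq1 mul1r.
rewrite inE; apply/asboolP => -[s [sG defF]].
pose ind (i : 'I_#|{: V}|) : k := (enum_val i \in F)%:R.
have var_ind (v : V) : meval ind (var k v) = (v \in F)%:R.
  by rewrite mevalXU /ind enum_rankK.
have : meval ind (face_monomial k F) = 1.
  by rewrite rmorph_prod /= big1 // => v Fv; rewrite var_ind Fv.
rewrite defF rmorph_sum big_seq big1 => [/esym/eqP|t ts]; first by rewrite oner_eq0.
have [p [q [le_pq ->]]] := sG t ts.
rewrite !rmorphM /= !var_ind; case Fp: (_ \in F); last by rewrite mul0r mulr0.
by case Fq: (_ \in F); [case/negP: (antiF p q Fp Fq) | rewrite !mulr0].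
Qed.

End LetterplaceComplexes.

Lemma ex_minimal_le (d : Order.disp_t) (P : finPOrderType d) (A : {set P}) y :
  y \in A -> exists b, minimal_in A b /\ (b <= y)%O.
Proof.
have [n] := ubnP #|[set x in A | (x < y)%O]%SET|; elim: n y => // n IHn y len Ay.
have [no_x|[x]] := set_0Vmem [set x in A | (x < y)%O]%SET.
  exists y; split=> //; split=> // x Ax le_xy; apply/eqP/negPn/negP => nxy.
  have : x \in [set x in A | (x < y)%O]%SET by rewrite inE Ax lt_neqAle nxy.
  by rewrite no_x inE.
rewrite inE => /andP[Ax lt_xy]; have [||b [minb le_bx]] := IHn x => //.
  rewrite -ltnS; apply: leq_trans len; rewrite ltnS.
  apply: proper_card; apply/properP; split.
    apply/fintype.subsetP=> z; rewrite !inE => /andP[-> /= lt_zx].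
    exact: lt_trans lt_zx lt_xy.
  by exists x; rewrite !inE Ax ?ltxx.
by exists b; split=> //; exact: le_trans le_bx (ltW lt_xy).
Qed.

Lemma ex_maximal_ge (d : Order.disp_t) (P : finPOrderType d) (A : {set P}) y :
  y \in A -> exists b, maximal_in A b /\ (y <= b)%O.
Proof. exact: (@ex_minimal_le _ P^d). Qed.

Section NotBelow.
Variables (k : fieldType) (d : Order.disp_t) (P : finPOrderType d).
Local Notation V := ('I_2 * P)%type.
Variables (R1 R2 : {set P}).

(** The vertices (2,y) with a <= y are dominated by (2,b), for b minimal below y;
    the apex is (1,a). *)
Lemma dominated_cone_above a :
  maximal_in R1 a -> ~ (exists2 b, minimal_in R2 b & (a <= b)%O) ->
  exists bad phi c, dominated_cone (Delta2 k P) (two_layers R1 R2) bad phi c.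
Proof.
move=> [R1a _] noB.
have /choice[m mP] : forall y, exists b, y \in R2 -> minimal_in R2 b /\ (b <= y)%O.
  move=> y; have [R2y|] := boolP (y \in R2); last by exists y.
  by have [b] := ex_minimal_le R2y; exists b.
exists (finset.setX [set ord_max]%SET [set y in R2 | (a <= y)%O]%SET),
  (fun v : V => (ord_max, m v.2)), (ord0, a); split.
- by rewrite !inE /= R1a.
- apply/fintype.subsetP => -[i y]; rewrite !inE /= => /and3P[-> -> _].
  by rewrite orbT.
- move=> [i y]; rewrite !inE /= => /and3P[_ R2y le_ay].
  have [minb _] := mP y R2y; rewrite (proj1 minb) /= andbT.
  by apply/negP => le_ab; apply: noB; exists (m y).
- move=> [i y] F /finset.setXP[/finset.set1P-> /finset.setIdP[R2y _]].
  move=> /Delta2P antiF _ Fy.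
  apply/Delta2P => p q; rewrite !inE !xpair_eqE /= => Fp.
  case/orP=> [/eqP->|]; last exact: antiF.
  apply: contra (antiF p y Fp Fy) => le_pb; exact: le_trans le_pb (proj2 (mP y R2y)).
- move=> F /Delta2P antiF /fintype.subsetP sFR; apply/Delta2P => p q.
  rewrite !inE !xpair_eqE /= => /orP[/eqP->|Fp] Fq; last exact: antiF.
  by have := sFR _ Fq; rewrite !inE /=; case: (q \in R2); rewrite ?andbT ?andbF.
Qed.

(** Dually, the vertices (1,x) with x <= b are dominated by (1,a), for a maximal
    above x; the apex is (2,b). *)
Lemma dominated_cone_under b :
  minimal_in R2 b -> ~ (exists2 a, maximal_in R1 a & (a <= b)%O) ->
  exists bad phi c, dominated_cone (Delta2 k P) (two_layers R1 R2) bad phi c.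
Proof.
move=> [R2b _] noA.
have /choice[m mP] : forall x, exists a, x \in R1 -> maximal_in R1 a /\ (x <= a)%O.
  move=> x; have [R1x|] := boolP (x \in R1); last by exists x.
  by have [a] := ex_maximal_ge R1x; exists a.
exists (finset.setX [set ord0]%SET [set x in R1 | (x <= b)%O]%SET),
  (fun v : V => (ord0, m v.2)), (ord_max, b); split.
- by rewrite !inE /= R2b.
- by apply/fintype.subsetP => -[i x]; rewrite !inE /= => /and3P[-> -> _].
- move=> [i x]; rewrite !inE /= => /and3P[_ R1x le_xb].
  have [maxa _] := mP x R1x; rewrite (proj1 maxa) /= andbT.
  by apply/negP => le_ab; apply: noA; exists (m x).
- move=> [i x] F /finset.setXP[/finset.set1P-> /finset.setIdP[R1x _]].
  move=> /Delta2P antiF _ Fx.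
  apply/Delta2P => p q; rewrite !inE !xpair_eqE /=.
  case/orP=> [/eqP-> Fq|]; last exact: antiF.
  apply: contra (antiF x q Fx Fq); exact: le_trans (proj2 (mP x R1x)).
- move=> F /Delta2P antiF /fintype.subsetP sFR; apply/Delta2P => p q.
  rewrite !inE !xpair_eqE /= => Fp /orP[/eqP->|Fq]; last exact: antiF.
  by have := sFR _ Fp; rewrite !inE /=; case: (p \in R1); rewrite ?andbT ?andbF.
Qed.

Lemma dominated_cone_not_le : ~ set_le R1 R2 ->
  exists bad phi c, dominated_cone (Delta2 k P) (two_layers R1 R2) bad phi c.
Proof.
move/not_andP => [/existsNP[a]|/existsNP[b]] /not_implyP[].
  exact: dominated_cone_above.
exact: dominated_cone_under.
Qed.

End NotBelow.

Theorem corollary3p8 (R : realType) (k : fieldType) (d : Order.disp_t)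
    (P : finPOrderType d) (R1 R2 : {set P})
    (hR1 : R1 != finset.set0) (hR2 : R2 != finset.set0) :
  (~ set_le R1 R2 ->
     let K := restriction (Delta2 k P) (two_layers R1 R2) in
     contractible R K /\
     (forall c : nat, reduced_homology_dim k K c = 0)) /\
  (forall i b : nat,
     is_betti_number (letterplace2 k P) i (support_mnm (two_layers R1 R2)) b ->
     b <> 0 -> set_le R1 R2).
Proof.
have cK : simplicial_complex (Delta2 k P) := @Delta2_complex k d P.
split=> [/(dominated_cone_not_le k)[bad [phi [c dc]]] K|i b [F <-]].
  split=> [|n]; last first.
    by apply: acyclic_reduced_homology; exact: dominated_cone_acyclic dc.
  apply: dominated_cone_contractible dc => //.
  by apply/Delta2P => p q; rewrite inE.
apply: contra_notP => /(dominated_cone_not_le k)[bad [phi [c dc]]].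
exact: tor_dominated_cone dc.
Qed.
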